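(* Let $n$ be a positive integer and let $q=p^r \equiv 1 \pmod n$ be a power of an odd prime $p$. Let $m\in\mathbb{Z}^+$ and $a_1,\dots,a_m,b_1,\dots,b_m\in\mathbb{Q}\cap\mathbb{Z}_p$. If $\lambda \in \mathbb{F}_q$ is not an $n$-th power in $\mathbb{F}_q$, then $${}_{nm}G_{nm}\left[ \begin{array}{c} a_i+\frac{l}{n} : 1 \leq i \leq m,\ 0 \leq l \leq n-1 \\ b_i+\frac{l}{n} : 1 \leq i \leq m,\ 0 \leq l \leq n-1 \end{array} \Big| \; \lambda \right]_q =0.$$
   Context: $\mathbb{Z}_p$ is the ring of $p$-adic integers and $\Gamma_p$ is Morita's $p$-adic gamma function: $\Gamma_p(n):=(-1)^n\prod_{0<j<n,\,p\nmid j}j$ for $n\in\mathbb{Z}^+$, extended continuously to $\mathbb{Z}_p$, with $\Gamma_p(0)=1$. $\omega:\mathbb{F}_q^*\to\mathbb{Z}_q^{\times}$ is the Teichmüller character ($\mathbb{Z}_q$ the ring of integers of the unramified extension of $\mathbb{Q}_p$ with residue field $\mathbb{F}_q$; $\omega(x)$ is the $(q-1)$-st root of unity congruent to $x$ mod $p$), $\overline{\omega}$ is its inverse, and all powers (including the trivial one) are extended by the value $0$ at $0\in\mathbb{F}_q$. For $x\in\mathbb{Q}$, $\lfloor x\rfloor$ is the floor and $\langle x\rangle=x-\lfloor x\rfloor$. Definition of ${}_mG_m$: for $q=p^r$, $p$ an odd prime, $\lambda\in\mathbb{F}_q$, $a_i,b_i\in\mathbb{Q}\cap\mathbb{Z}_p$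 ($1\le i\le m$), $${}_{m}G_{m}\left[ \begin{array}{ccc} a_1, & \dots, & a_m \\ b_1, & \dots, & b_m \end{array} \Big| \; \lambda \right]_q := \frac{-1}{q-1} \sum_{j=0}^{q-2} (-1)^{jm}\, \overline{\omega}^j(\lambda) \prod_{i=1}^{m} \prod_{k=0}^{r-1} \frac{\Gamma_p(\langle (a_i -\frac{j}{q-1} )p^k \rangle)}{\Gamma_p(\langle a_i p^k \rangle)} \frac{\Gamma_p(\langle (-b_i +\frac{j}{q-1}) p^k \rangle)}{\Gamma_p(\langle -b_i p^k\rangle)} (-p)^{-\lfloor\langle a_i p^k \rangle -\frac{j p^k}{q-1}\rfloor -\lfloor\langle -b_i p^k\rangle +\frac{j p^k}{q-1}\rfloor}.$$ *)

(* Defs.v *)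
From HB Require Import structures.
From mathcomp Require Import all_boot all_order all_algebra generic_quotient.
From mathcomp Require Import cyclic all_field.
From mathcomp Require Import boolp classical_sets.

Set Implicit Arguments.
Unset Strict Implicit.
Unset Printing Implicit Defensive.

Import Order.TTheory GRing.Theory Num.Theory.

Local Open Scope ring_scope.

(* Z_p is the inverse limit of the rings Z/p^n: a p-adic integer is the       *)
(* sequence of its canonical residues modulo p ^ 0, p ^ 1, p ^ 2, ...         *)
Record padicint (p : nat) (p_pr : prime p) := Padicint {
  residue :> nat -> nat;
  _ : `[< forall n, residue n = (residue n.+1 %% p ^ n)%N >]
}.

Section PadicInt.
Variables (p : nat) (p_pr : prime p).
Local Notation Zp := (padicint p_pr).

HB.instance Definition _ := [isSub for @residue p p_pr].
HB.instance Definition _ := gen_eqMixin Zp.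
HB.instance Definition _ := gen_choiceMixin Zp.

Implicit Types (x y z : Zp) (n : nat).

Lemma expp_gt0 n : (0 < p ^ n)%N.
Proof. by rewrite expn_gt0 prime_gt0. Qed.

Lemma residueS x n : (x n.+1 %% p ^ n)%N = x n.
Proof. by case: x => f /= /asboolP/(_ n). Qed.

Lemma residue_ltn x n : (x n < p ^ n)%N.
Proof. by rewrite -residueS ltn_pmod ?expp_gt0. Qed.

Lemma residue_mod x n : (x n %% p ^ n)%N = x n.
Proof. by rewrite modn_small ?residue_ltn. Qed.

Lemma residueD x n k : (x (n + k) %% p ^ n)%N = x n.
Proof.
elim: k => [|k IH]; first by rewrite addn0 residue_mod.
by rewrite -[RHS]IH -(residueS x (n + k)) addnS modn_dvdm // dvdn_exp2l ?leq_addr.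
Qed.

Lemma padicintP x y : (forall n, x n = y n) <-> x = y.
Proof.
by split=> [xy|-> //]; apply: val_inj; apply/funext.
Qed.

Lemma padicint_subproof (f : nat -> nat) :
    (forall n, f n.+1 = f n %[mod p ^ n]) ->
  `[< forall n, (f n %% p ^ n)%N = (f n.+1 %% p ^ n.+1 %% p ^ n)%N >].
Proof.
by move=> fP; apply/asboolP=> n; rewrite modn_dvdm ?dvdn_exp2l // fP.
Qed.

Definition padic_lim (f : nat -> nat) (fP : forall n, f n.+1 = f n %[mod p ^ n])
  : Zp := Padicint p_pr (padicint_subproof fP).

Lemma padic_add_subproof x y n : (x n.+1 + y n.+1 = x n + y n %[mod p ^ n])%N.
Proof. by rewrite -modnDm !residueS. Qed.
Definition padic_add x y := padic_lim (padic_add_subproof x y).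

Lemma padic_mul_subproof x y n : (x n.+1 * y n.+1 = x n * y n %[mod p ^ n])%N.
Proof. by rewrite -modnMm !residueS. Qed.
Definition padic_mul x y := padic_lim (padic_mul_subproof x y).

Lemma padic_opp_subproof x n :
  (p ^ n.+1 - x n.+1 = p ^ n - x n %[mod p ^ n])%N.
Proof.
apply/eqP; rewrite -(eqn_modDr (x n)) subnK ?modnn; last exact/ltnW/residue_ltn.
rewrite -modnDmr -(residueS x n) modn_mod modnDmr subnK ?expnS ?modnMl //.
by rewrite -expnS; apply/ltnW/residue_ltn.
Qed.
Definition padic_opp x := padic_lim (padic_opp_subproof x).

Lemma padic_nat_subproof m n : (m = m %[mod p ^ n])%N.
Proof. by []. Qed.
Definition padic_nat m := padic_lim (padic_nat_subproof m).

Let padic_addA : associative padic_add.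
Proof. by move=> x y z; apply/padicintP=> n /=; rewrite modnDml modnDmr addnA. Qed.
Let padic_addC : commutative padic_add.
Proof. by move=> x y; apply/padicintP=> n /=; rewrite addnC. Qed.
Let padic_add0 : left_id (padic_nat 0) padic_add.
Proof. by move=> x; apply/padicintP=> n /=; rewrite modnDml residue_mod. Qed.
Let padic_addN : left_inverse (padic_nat 0) padic_opp padic_add.
Proof.
move=> x; apply/padicintP=> n /=; rewrite modnDml subnK ?modnn ?mod0n //.
exact/ltnW/residue_ltn.
Qed.
HB.instance Definition _ :=
  GRing.isZmodule.Build Zp padic_addA padic_addC padic_add0 padic_addN.

Let padic_mulA : associative padic_mul.
Proof. by move=> x y z; apply/padicintP=> n /=; rewrite modnMml modnMmr mulnA. Qed.
Let padic_mulC : commutative padic_mul.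
Proof. by move=> x y; apply/padicintP=> n /=; rewrite mulnC. Qed.
Let padic_mul1 : left_id (padic_nat 1) padic_mul.
Proof. by move=> x; apply/padicintP=> n /=; rewrite modnMml mul1n residue_mod. Qed.
Let padic_mulD : left_distributive padic_mul padic_add.
Proof.
by move=> x y z; apply/padicintP=> n /=; rewrite modnMml modnDm mulnDl.
Qed.
Let padic_1neq0 : padic_nat 1 != 0.
Proof.
apply/eqP=> /padicintP/(_ 1%N) /=.
by rewrite expn1 mod0n modn_small ?prime_gt1.
Qed.
HB.instance Definition _ := GRing.Zmodule_isComNzRing.Build Zp
  padic_mulA padic_mulC padic_mul1 padic_mulD padic_1neq0.

Lemma residue_add x y n : (x + y) n = ((x n + y n) %% p ^ n)%N.
Proof. by []. Qed.

Lemma residue_mul x y n : (x * y) n = ((x n * y n) %% p ^ n)%N.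
Proof. by []. Qed.

Lemma residue0 n : (0 : Zp) n = 0%N.
Proof. exact: mod0n. Qed.

Lemma residue_nat m n : (m%:R : Zp) n = (m %% p ^ n)%N.
Proof.
elim: m => [|m IH]; first by rewrite residue0 mod0n.
by rewrite -natr1 residue_add IH /= modnDm addn1.
Qed.

Lemma residueX x k n : (x ^+ k) n = (x n ^ k %% p ^ n)%N.
Proof.
elim: k => [|k IH]; first by rewrite expr0 expn0 (residue_nat 1).
by rewrite exprS residue_mul IH modnMmr expnS.
Qed.

Definition padic_unit : pred Zp := fun x => x 1%N != 0%N.

Lemma padic_unit_coprime x n : padic_unit x -> coprime (x n) (p ^ n).
Proof.
case: n => [|n] ux; first by rewrite expn0 coprimen1.
rewrite coprime_pexpr // coprime_sym prime_coprime //.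
by rewrite /dvdn; have := residueD x 1 n; rewrite add1n expn1 => ->.
Qed.

Lemma padic_inv_subproof x n :
  ((if padic_unit x then x n.+1 ^ (totient (p ^ n.+1)).-1 else x n.+1) =
   (if padic_unit x then x n ^ (totient (p ^ n)).-1 else x n) %[mod p ^ n])%N.
Proof.
case: ifP => ux; last by rewrite residueS residue_mod.
have xV k : (x k * x k ^ (totient (p ^ k)).-1 = 1 %[mod p ^ k])%N.
  rewrite -expnS prednK ?totient_gt0 ?expp_gt0 //.
  by rewrite Euler_exp_totient ?padic_unit_coprime.
have eqV a b : (x n * a = 1 %[mod p ^ n] -> x n * b = 1 %[mod p ^ n] ->
    a = b %[mod p ^ n])%N.
  move=> xa xb; rewrite -(mul1n a) -modnMml -xb modnMml mulnAC -modnMml xa.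
  by rewrite modnMml mul1n.
apply: eqV (xV n); have /(congr1 (fun a => a %% p ^ n)%N) := xV n.+1.
by rewrite !modn_dvdm ?dvdn_exp2l // -modnMml residueS.
Qed.
Definition padic_inv x := padic_lim (padic_inv_subproof x).

Let padic_mulV : {in padic_unit, left_inverse 1 padic_inv *%R}.
Proof.
move=> x ux; apply/padicintP=> n; rewrite residue_mul /= (ux : padic_unit x) modnMml.
rewrite mulnC -expnS prednK ?totient_gt0 ?expp_gt0 //.
by rewrite Euler_exp_totient ?padic_unit_coprime.
Qed.
Let padic_unitP x y : y * x = 1 -> padic_unit x.
Proof.
move=> /padicintP/(_ 1%N); rewrite residue_mul /padic_unit.
apply: contra_eqN => /eqP ->; rewrite muln0 mod0n (residue_nat 1) expn1.
by rewrite modn_small ?prime_gt1.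
Qed.
Let padic_inv_out : {in [predC padic_unit], padic_inv =1 id}.
Proof.
move=> x ux; apply/padicintP=> n /=.
by rewrite (negbTE (ux : ~~ padic_unit x)) residue_mod.
Qed.
HB.instance Definition _ := GRing.ComNzRing_hasMulInverse.Build Zp
  padic_mulV padic_unitP padic_inv_out.

Lemma padic_eq0P x : reflect (exists n, ~~ (p ^ n %| x n)%N) (x != 0).
Proof.
apply: (iffP idP) => [|[n]]; last by apply: contraNneq => ->; rewrite residue0 dvdn0.
move=> /eqP x_neq0; apply: contrapT => /forallNP xP; apply: x_neq0.
apply/padicintP=> n; rewrite residue0.
by have /negP := xP n; rewrite negbK /dvdn residue_mod => /eqP.
Qed.

Let padic_idomain x y : x * y = 0 -> (x == 0) || (y == 0).
Proof.
move=> xy0; apply/negP=> /negP; rewrite negb_or => /andP[].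
move=> /padic_eq0P[n xn] /padic_eq0P[m ym].
have xn' : ~~ (p ^ n %| x (n + m))%N by rewrite /dvdn residueD -(residue_mod x n).
have ym' : ~~ (p ^ m %| y (n + m))%N.
  by rewrite /dvdn addnC residueD -(residue_mod y m).
have /eqP := congr1 (fun z : Zp => z (n + m)%N) xy0.
rewrite residue_mul residue0 -/(dvdn _ _).
have x_gt0 : (0 < x (n + m))%N by case: posnP xn' => // ->; rewrite dvdn0.
have y_gt0 : (0 < y (n + m))%N by case: posnP ym' => // ->; rewrite dvdn0.
rewrite pfactor_dvdn ?muln_gt0 ?x_gt0 // lognM //.
move: xn' ym'; rewrite !pfactor_dvdn // -!ltnNge => a b.
by rewrite leqNgt -addSn leq_add // ltnW.
Qed.
HB.instance Definition _ := GRing.ComUnitRing_isIntegral.Build Zp padic_idomain.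

End PadicInt.

Section Morita.
Variables (p : nat) (p_pr : prime p).
Local Notation Zp := (padicint p_pr).
Implicit Types (x y z : Zp) (n : nat).

(* continuity for the p-adic topology: y M = x M means y = x mod p ^ M *)
Definition padic_continuous (G : Zp -> Zp) :=
  forall x N, exists M, forall y, y M = x M -> G y N = G x N.

Definition morita_nat n : Zp :=
  (-1) ^+ n * \prod_(1 <= j < n | ~~ (p %| j)%N) j%:R.

Definition is_morita_gamma (G : Zp -> Zp) :=
  [/\ padic_continuous G, forall n, (0 < n)%N -> G n%:R = morita_nat n
    & G 0 = 1].

Definition morita_gamma : Zp -> Zp := xget (fun=> 1) is_morita_gamma.

Lemma is_morita_gamma_unique G H :
  is_morita_gamma G -> is_morita_gamma H -> G = H.
Proof.
move=> [Gc Gn _] [Hc Hn _]; apply/funext => x; apply/padicintP=> N.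
have [M GM] := Gc x N; have [K HK] := Hc x N.
pose k := (x (M + K) + p ^ (M + K))%N.
have k_gt0 : (0 < k)%N by rewrite addn_gt0 expp_gt0 // orbT.
have kE n : (n <= M + K)%N -> (k%:R : Zp) n = x n.
  move=> le_n; have /eqP dv : (p ^ n %| p ^ (M + K))%N by rewrite dvdn_exp2l.
  by rewrite residue_nat -modnDmr dv addn0 -(subnKC le_n) residueD.
by rewrite -(GM k%:R) ?kE ?leq_addr // -(HK k%:R) ?kE ?leq_addl // Gn ?Hn.
Qed.

Hypothesis p_odd : odd p.

Let two_ndvd : ~~ (p %| 2)%N.
Proof.
by move: p_odd; apply: contraL => /prime_nt_dvdP -> //; case: p p_pr => [|[]].
Qed.

Let unit_prod N :
  let M := (p ^ N.+1)%N in let W : 'Z_M := \prod_(x : 'Z_M | x \is a GRing.unit) x in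
  W ^+ 2 = 1.
Proof.
move=> M W; rewrite expr2 {2}/W (reindex_inj invr_inj) /=.
rewrite (eq_bigl (fun x : 'Z_M => x \is a GRing.unit)) => [|x]; last by rewrite unitrV.
by rewrite -big_split big1 // => x /divrr.
Qed.

Let pM_gt1 N : (1 < p ^ N.+1)%N.
Proof. by rewrite -(exp1n N.+1) ltn_exp2r // prime_gt1. Qed.

Let prod_unit N : let M := (p ^ N.+1)%N in
  (\prod_(0 <= j < M | ~~ (p %| j)) j)%N%:R
  = \prod_(x : 'Z_M | x \is a GRing.unit) x.
Proof.
move=> M; have M1 : (1 < M)%N := pM_gt1 N.
rewrite natr_prod -[X in index_iota 0 X](Zp_cast M1) big_mkord.
apply: eq_big => [x|x _]; last by rewrite natr_Zp.
by rewrite -[x in RHS]natr_Zp unitZpE // coprime_pexpl // prime_coprime.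
Qed.

Let wilson_blocks k :
  (\prod_(0 <= j < k * p | ~~ (p %| j)%N) j%:R : 'F_p) = (-1) ^+ k.
Proof.
elim: k => [|k IH]; first by rewrite big_geq.
rewrite mulSn addnC (big_cat_nat (n := (k * p)%N)) ?leq_addr //= IH exprSr.
congr (_ * _); rewrite -{1}[(k * p)%N]add0n big_addn addKn.
under eq_bigl do rewrite dvdn_addl ?dvdn_mull //.
under eq_bigr do rewrite natrD natrM pchar_Fp_0 // mulr0 addr0.
have : ((p.-1)`!.+1%:R : 'F_p) == 0.
  by rewrite -(dvdn_pcharf (pchar_Fp p_pr)) -Wilson ?prime_gt1.
rewrite -natr1 addr_eq0 => /eqP <-; rewrite fact_prod natr_prod.
rewrite prednK ?prime_gt0 // big_ltn_cond ?prime_gt0 // dvdn0 /=.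
rewrite big_nat_cond [RHS]big_nat_cond; apply: eq_bigl => i.
by case: (boolP (0 < i < p)%N) => //= /andP[i_gt0 lt_ip]; rewrite gtnNdvd.
Qed.

Let wilson0 N :
  (p ^ N %| (\prod_(0 <= j < p ^ N | ~~ (p %| j)) j).+1)%N.
Proof.
case: N => [|N]; first exact: dvd1n.
set P := (\prod_(0 <= j < _ | _) _)%N.
have P_modp : (p %| P.+1)%N.
  rewrite (dvdn_pcharf (pchar_Fp p_pr)) -natr1 /P expnSr natr_prod wilson_blocks.
  by rewrite -signr_odd oddX p_odd orbT addNr.
have P2 : (p ^ N.+1 %| P ^ 2 - 1)%N.
  have P_gt0 : (0 < P)%N.
    by rewrite prodn_cond_gt0 // => j; apply: contraNT; rewrite -eqn0Ngt => /eqP->.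
  rewrite -eqn_mod_dvd ?expn_gt0 ?P_gt0 //; apply/eqP.
  rewrite -!(val_Zp_nat (pM_gt1 N)); congr (val _).
  by rewrite natrX prod_unit unit_prod.
have E : (P ^ 2 - 1 = (P - 1) * P.+1)%N by rewrite -[P.+1]addn1 -subn_sqr exp1n.
move: P2; rewrite E Gauss_dvdr //.
rewrite coprime_pexpl // prime_coprime //; apply: contra two_ndvd => pP.
have P_gt0 : (0 < P)%N.
  by rewrite lt0n; apply: contraTneq P_modp => ->; rewrite dvdn1 neq_ltn prime_gt1 ?orbT.
have -> : 2%N = (P.+1 - (P - 1))%N by rewrite subnBA // addn1 subSn // subSnn.
by rewrite dvdn_sub.
Qed.

Let wilson N n :
  (p ^ N %| (\prod_(n <= j < n + p ^ N | ~~ (p %| j)) j).+1)%N.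
Proof.
elim: n => [|n IH]; first exact: wilson0.
case: N IH => [|N] IH; first exact: dvd1n.
set M := (p ^ N.+1)%N in IH *.
have M_gt0 : (0 < M)%N by rewrite expp_gt0.
have pM j : (p %| j + M)%N = (p %| j)%N.
  by rewrite dvdn_addl // /M expnS dvdn_mulr.
have eqW : ((if (p %| n)%N then 1 else n) *
      \prod_(n.+1 <= j < n.+1 + M | ~~ (p %| j)) j =
    (\prod_(n <= j < n + M | ~~ (p %| j)) j) *
      (if (p %| n)%N then 1 else n + M))%N.
  rewrite addSn ![in LHS]big_mkcond ![in RHS]big_mkcond /=.
  rewrite -[in RHS](pM n) -!(if_neg (p %| _)%N) -big_nat_recr ?leq_addr //.
  by rewrite -big_ltn ?ltnS ?leq_addr.
move: IH eqW; set A := (\prod_(n <= _ < _ | _) _)%N; set B := (\prod_(_ <= _ < _ | _) _)%N.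
case: ifP => pn IH eqW; first by move: eqW; rewrite mul1n muln1 => ->.
have cMn : coprime M n by rewrite coprime_pexpl // prime_coprime // pn.
rewrite -(Gauss_dvdr _ cMn) mulnS eqW mulnDr addnA dvdn_addl ?dvdn_mull //.
by rewrite -mulSn dvdn_mulr.
Qed.

Let wilson_padic N n :
  ((-1) ^+ (p ^ N) * \prod_(n <= i < n + p ^ N | ~~ (p %| i)%N) i%:R : Zp) N
  = (1 : Zp) N.
Proof.
rewrite -signr_odd oddX p_odd orbT expr1 mulN1r -natr_prod.
set P := (\prod_(_ <= _ < _ | _) _)%N.
have /eqP PN : (P.+1%:R : Zp) N == 0%N by rewrite residue_nat; apply: wilson.
have -> : - P%:R = 1 - P.+1%:R :> Zp by rewrite -natr1 opprD addrCA subrr addr0.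
by rewrite residue_add /= PN subn0 modnn addn0 (residue_mod (1 : Zp)).
Qed.

Let morita_natD N n : (0 < n)%N ->
  (morita_nat (n + p ^ N)) N = (morita_nat n) N.
Proof.
move=> n_gt0; rewrite /morita_nat (big_cat_nat (n := n)) ?leq_addr //.
rewrite exprD mulrACA [LHS]residue_mul wilson_padic.
by rewrite -residue_mul mulr1.
Qed.

Let morita_nat_mod N n k : (0 < n)%N ->
  (morita_nat (n + k * p ^ N)) N = (morita_nat n) N.
Proof.
move=> n_gt0; elim: k => [|k IH]; first by rewrite addn0.
by rewrite mulSn addnCA addnC morita_natD ?IH // ltn_addr.
Qed.

Let morita_lim_subproof x n :
  (morita_nat (x n.+1 + p ^ n.+1) n.+1 = morita_nat (x n + p ^ n) n
    %[mod p ^ n])%N.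
Proof.
rewrite residueS residue_mod {1}(divn_eq (x n.+1) (p ^ n)) residueS.
set d := (_ %/ _)%N.
have -> : (d * p ^ n + x n + p ^ n.+1 = x n + p ^ n + (d + p.-1) * p ^ n)%N.
  have -> : (p ^ n.+1 = p ^ n + p.-1 * p ^ n)%N.
    by rewrite -mulSn prednK ?prime_gt0 // expnS.
  by rewrite mulnDl [(_ + x n)%N]addnC -!addnA; congr (_ + _)%N; rewrite addnCA.
by rewrite morita_nat_mod // addn_gt0 expp_gt0 // orbT.
Qed.

Let morita_lim x := padic_lim p_pr (morita_lim_subproof x).

Let morita_limE x N : morita_lim x N = (morita_nat (x N + p ^ N)) N.
Proof. exact: residue_mod. Qed.

Lemma morita_gammaP : is_morita_gamma morita_gamma.
Proof.
apply: xgetPex; exists morita_lim; split=> [x N|n n_gt0|].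
- by exists N => y yx; rewrite !morita_limE yx.
- apply/padicintP=> N; rewrite morita_limE residue_nat.
  have pN_gt0 : (0 < p ^ N)%N by rewrite expp_gt0.
  rewrite -(morita_nat_mod _ (n %/ p ^ N)) ?addn_gt0 ?pN_gt0 ?orbT //.
  by rewrite addnAC [(n %% _ + _)%N]addnC -divn_eq morita_natD.
apply/padicintP=> N; rewrite morita_limE residue0 add0n -(wilson_padic N 0).
by rewrite /morita_nat add0n [in RHS]big_ltn_cond ?expp_gt0 // dvdn0.
Qed.

End Morita.

Definition padic_in (p : nat) (p_pr : prime p)
    (L : fieldExtType {fraction padicint p_pr}) : padicint p_pr -> L :=
  in_alg L \o @FracField.tofrac (padicint p_pr).

HB.instance Definition _ p p_pr L := GRing.RMorphism.on (@padic_in p p_pr L).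

Definition integral_pred (p : nat) (p_pr : prime p)
    (L : fieldExtType {fraction padicint p_pr}) : {pred L} :=
  fun x => `[< integralOver (@padic_in p p_pr L) x >].

(* the ring of integers of L, as a subring of L *)
Record ring_of_integers (p : nat) (p_pr : prime p)
    (L : fieldExtType {fraction padicint p_pr}) := RingOfIntegers {
  int_val :> L;
  _ : integral_pred int_val
}.

Section RingOfIntegers.
Variables (p : nat) (p_pr : prime p).
Variable L : fieldExtType {fraction padicint p_pr}.
Local Notation O := (ring_of_integers L).

Let integral_subring : subring_closed (@integral_pred p p_pr L).
Proof.
split=> [|x y /asboolP ix /asboolP iy|x y /asboolP ix /asboolP iy];
  apply/asboolP; first exact: integral1.
- exact: integral_sub.
exact: integral_mul.
Qed.
HB.instance Definition _ := GRing.isSubringClosed.Build L (@integral_pred p p_pr L)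
  integral_subring.

HB.instance Definition _ := [isSub of O for @int_val p p_pr L].
HB.instance Definition _ := [Choice of O by <:].
HB.instance Definition _ := [SubChoice_isSubComNzRing of O by <:].

End RingOfIntegers.

(* L is unramified over Q_p with residue field F, red being the reduction:    *)
(* the kernel of red, i.e. the maximal ideal of the ring of integers, is (p)  *)
Definition unramified_with_residue_field (p : nat) (p_pr : prime p)
    (L : fieldExtType {fraction padicint p_pr}) (F : finFieldType)
    (red : {rmorphism ring_of_integers L -> F}) :=
  (forall c : F, exists x, red x = c) /\
  (forall x, red x = 0 <-> exists y, x = p%:R * y).

Section Teichmuller.
Variables (p : nat) (p_pr : prime p).
Variable L : fieldExtType {fraction padicint p_pr}.
Variables (F : finFieldType) (red : {rmorphism ring_of_integers L -> F}).
Local Notation O := (ring_of_integers L).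
Local Notation Zp := (padicint p_pr).

(* red t = c says that t is congruent to c modulo p *)
Definition is_teichmuller (c : F) (t : O) :=
  t ^+ (#|F|.-1) = 1 /\ red t = c.

Definition teichmuller (c : F) : O := xget 0 (is_teichmuller c).

(* the j-th power of the inverse of the Teichmuller character, with value 0   *)
(* at 0 for all j, including j = 0                                            *)
Definition teichmuller_inv_exp (j : nat) (c : F) : L :=
  if c == 0 then 0 else (int_val (teichmuller c))^-1 ^+ j.

Lemma padic_dvdP (x : Zp) : x 1%N = 0%N -> exists y, x = p%:R * y.
Proof.
move=> x1; have pp := prime_gt0 p_pr.
have dvx n : (p %| x n.+1)%N.
  have := residueD x 1 n; rewrite add1n x1 expn1 => e.
  by rewrite /dvdn e.
have fP n : ((x n.+2 %/ p) = (x n.+1 %/ p) %[mod p ^ n])%N.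
  apply/eqP; rewrite -(eqn_pmul2l pp) !muln_modr !(mulnC p (_ %/ _)%N) !divnK //.
  by rewrite -expnS residueS residue_mod.
exists (padic_lim p_pr fP); apply/padicintP => n.
rewrite residue_mul residue_nat modnMml /= modnMmr mulnC divnK //.
by rewrite residueS.
Qed.

Lemma padic_dvdXP n (x : Zp) : x n = 0%N -> exists y, x = p%:R ^+ n * y.
Proof.
elim: n => [|n IH] xn; first by exists x; rewrite expr0 mul1r.
have [|y xE] := IH; first by rewrite -residueS xn mod0n.
have [|z yE] := @padic_dvdP y; last by exists z; rewrite exprSr -mulrA -yE.
move: xn; rewrite xE residue_mul -natrX residue_nat modnMml expnSr -muln_modr.
move/eqP; rewrite muln_eq0 expn_eq0 eqn0Ngt prime_gt0 //= => /eqP.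
by have := residueD y 1 n; rewrite add1n expn1 => ->.
Qed.

Lemma padic_valP (x : Zp) : x != 0 ->
  exists n u, u \is a GRing.unit /\ x = p%:R ^+ n * u.
Proof.
move=> /padic_eq0P[n]; elim: n x => [|n IH] x; first by rewrite dvd1n.
case: (eqVneq (x 1%N) 0%N) => [x1 xn|x1 _]; last first.
  by exists 0%N, x; split=> //; rewrite expr0 mul1r.
have [y xE] := padic_dvdP x1.
case: (IH y) => [|m [u [uu yE]]]; last first.
  by exists m.+1, u; split=> //; rewrite xE yE exprS mulrA.
apply: contraNN xn => yn; rewrite xE residue_mul residue_nat modnMml.
rewrite /dvdn modn_mod expnS -muln_modr muln_eq0; apply/orP; right.
by rewrite residueS -residue_mod.
Qed.

Let frac_denom (x : {fraction Zp}) : exists2 d : Zp, d != 0 &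
  exists n : Zp, FracField.tofrac d * x = FracField.tofrac n.
Proof.
elim/quotW: x => -[[n d] /= d0]; exists d => //; exists n.
unlock FracField.tofrac; rewrite -[LHS]FracField.pi_mul; apply/eqmodP.
rewrite /= FracField.equivfE /FracField.mulf /= !numden_Ratio ?oner_eq0 ?mulf_neq0 //.
by rewrite !mulr1 mul1r. all: exact: oner_neq0.
Qed.

Lemma common_denom (s : seq {fraction Zp}) : exists2 d : Zp, d != 0 &
  forall x, x \in s -> exists a : Zp, FracField.tofrac d * x = FracField.tofrac a.
Proof.
elim: s => [|x s [d d0 IH]]; first by exists 1; rewrite ?oner_neq0.
have [e e0 [n xE]] := frac_denom x.
exists (d * e); first by rewrite mulf_neq0.
move=> y; rewrite inE => /predU1P[->|/IH[a ya]].
  by exists (d * n); rewrite !tofracM -mulrA xE.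
by exists (e * a); rewrite !tofracM mulrAC ya mulrC.
Qed.

Lemma algebraic_denom (u : L) : exists2 d : Zp, d != 0 &
  integral_pred (padic_in L d * u).
Proof.
have /polyOver1P[P PE] := minPolyOver 1%AS u.
have Pm : map_poly (in_alg L) P \is monic by rewrite -PE monic_minPoly.
have Pu : root (map_poly (in_alg L) P) u by rewrite -PE root_minPoly.
have [d d0 dP] := common_denom P.
exists d => //; set D := padic_in L d; set m := (size P).-1.
have szP : size P = m.+1.
  by rewrite /m prednK // lt0n size_poly_eq0; move: Pm; rewrite map_monic => /monic_neq0.
pose Q := \poly_(i < m.+1) ((P`_i)%:A * D ^+ (m - i)) : {poly L}.
have Pm1 : P`_m = 1 by apply/eqP; move: Pm; rewrite map_monic.
have D0 : D != 0 by rewrite fmorph_eq0 tofrac_eq0.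
have Qm : Q`_m = 1 by rewrite coef_poly ltnSn subnn mulr1 Pm1 scale1r.
apply/asboolP; apply: (@integral_root_monic _ _ _ _ Q).
- rewrite monicE lead_coefE size_poly_eq /= ?subnn ?mulr1 ?Pm1 ?scale1r ?oner_neq0 //.
  by rewrite Qm.
- apply/rootP; rewrite horner_poly.
  move/rootP: Pu; rewrite horner_coef size_map_poly szP => Pu.
  move/(congr1 ( *%R (D ^+ m))): Pu; rewrite mulr0 mulr_sumr => Pu; rewrite -[RHS]Pu {Pu}; apply: eq_bigr => i _.
  rewrite coef_map exprMn /= !mulrA [_ * D ^+ i]mulrAC; congr (_ * _).
  by rewrite -mulrA -exprD subnKC 1?mulrC // -ltnS.
apply/integral_poly => i; rewrite coef_poly; case: ltnP => [lt_i|_]; last exact: integral0.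
case: (ltnP i m) => [lt_im|le_mi]; last first.
  have -> : i = m by apply/eqP; rewrite eqn_leq le_mi -ltnS lt_i.
  by rewrite subnn mulr1 Pm1 scale1r; apply: integral1.
have -> : (m - i = (m - i.+1).+1)%N by rewrite subnSK.
rewrite exprS mulrA; apply: integral_mul.
  have [|a aP] := dP (P`_i); first by rewrite mem_nth // szP.
  have -> : (P`_i)%:A * D = padic_in L a.
    by rewrite /D /padic_in /= -aP -[RHS]/(in_alg L _) rmorphM mulrC.
  exact: integral_id.
by rewrite /D -rmorphXn; apply: integral_id.
Qed.

Let padic_inO_subproof (x : Zp) : integral_pred (padic_in L x).
Proof. by apply/asboolP; apply: integral_id. Qed.
Let iO (x : Zp) : O := RingOfIntegers (padic_inO_subproof x).

Let iOD x y : iO (x + y) = iO x + iO y.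
Proof. by apply: val_inj; rewrite /= rmorphD. Qed.
Let iOM x y : iO (x * y) = iO x * iO y.
Proof. by apply: val_inj; rewrite /= rmorphM. Qed.
Let iO_nat n : iO n%:R = n%:R.
Proof. by apply: val_inj; rewrite [RHS](rmorph_nat val); apply: rmorph_nat. Qed.

Let mulO_eq0 (x y : O) : x * y = 0 -> x = 0 \/ y = 0.
Proof.
move=> /(congr1 val); rewrite rmorphM rmorph0 => /eqP; rewrite mulf_eq0.
by case/orP=> /eqP e; [left|right]; apply: val_inj; rewrite e rmorph0.
Qed.

Hypothesis unram : unramified_with_residue_field red.

Let red_p : red p%:R = 0.
Proof. by apply/unram.2; exists 1; rewrite mulr1. Qed.

Let natrO_neq0 : (p%:R : O) <> 0.
Proof.
move=> /(congr1 val); rewrite rmorph_nat rmorph0 => /eqP.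
rewrite -(rmorph_nat (padic_in L)) fmorph_eq0 tofrac_eq0 => /eqP/padicintP/(_ 2).
rewrite residue0 residue_nat modn_small => [p0|]; first by move: p_pr; rewrite p0.
by rewrite -{1}(expn1 p) ltn_exp2l ?prime_gt1.
Qed.

Let dvd (n : nat) (x : O) := exists y, x = p%:R ^+ n * y.

Let dvdD n x y : dvd n x -> dvd n y -> dvd n (x + y).
Proof. by move=> [u ->] [v ->]; exists (u + v); rewrite mulrDr. Qed.
Let dvdMl n x y : dvd n x -> dvd n (y * x).
Proof. by move=> [u ->]; exists (y * u); rewrite mulrCA. Qed.
Let dvdN n x : dvd n x -> dvd n (- x).
Proof. by rewrite -mulN1r; apply: dvdMl. Qed.
Let dvdW n m x : (n <= m)%N -> dvd m x -> dvd n x.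
Proof. by move=> /subnKC <- [u ->]; exists (p%:R ^+ (m - n) * u); rewrite mulrA exprD. Qed.
Let dvd_trans n x y z : dvd n (x - y) -> dvd n (y - z) -> dvd n (x - z).
Proof. by move=> a b; rewrite -(subrKA y); apply: dvdD. Qed.
Let dvd_sym n x y : dvd n (x - y) -> dvd n (y - x).
Proof. by move/dvdN; rewrite opprB. Qed.

Let separated x : (forall n, dvd n x) -> x = 0.
Proof.
move=> dvx; apply/eqP; apply: contrapT => /negP x0.
have vx0 : val x != 0.
  by apply: contraNneq x0 => e; apply/eqP/val_inj; rewrite e rmorph0.
have [d d0 id] := algebraic_denom (val x)^-1.
pose w : O := RingOfIntegers id.
have xw : x * w = iO d.
  by apply: val_inj; rewrite rmorphM /= mulrCA divff ?mulr1.
have [N [u [uu dE]]] := padic_valP d0.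
have [z zE] := dvx N.+1.
have : iO (p%:R ^+ N * u) = p%:R ^+ N * (p%:R * z * w).
  by rewrite -dE -xw zE exprSr !mulrA.
rewrite iOM; have -> : iO (p%:R ^+ N) = p%:R ^+ N by rewrite -natrX iO_nat natrX.
move=> /eqP; rewrite -subr_eq0 -mulrBr => /eqP.
have pN : (p%:R ^+ N : O) <> 0.
  elim: N {dE zE} => [|N IH]; first exact/eqP/oner_neq0.
  by rewrite exprS => /mulO_eq0[].
case/mulO_eq0 => // /eqP; rewrite subr_eq0 => /eqP /(congr1 ( *%R (iO u^-1))).
rewrite -iOM mulVr // (iO_nat 1) => /(congr1 red) /eqP.
by rewrite !rmorphM red_p rmorph1 mul0r mul0r mulr0 oner_eq0.
Qed.

Let complete (t : nat -> O) : (forall n, dvd n (t n.+1 - t n)) ->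
  exists u, forall n, dvd n (u - t n).
Proof.
move=> /choice[e eE].
have [s sE] := choice unram.1.
have /choice[dv dvE] : forall x, exists y, x = s (red x) + p%:R * y.
  move=> x; have /unram.2[y yE] : red (x - s (red x)) = 0.
    by rewrite rmorphB sE subrr.
  by exists y; rewrite -yE subrKC.
pose w := fix w n := if n is n'.+1 then dv (w n' + e n') else t 0.
pose c n := red (w n + e n).
have fP a n : (\sum_(i < n.+1 | c i == a) p ^ i =
    \sum_(i < n | c i == a) p ^ i %[mod p ^ n])%N.
  rewrite big_mkcond big_ord_recr /= -big_mkcond /=.
  by case: ifP => _; rewrite ?addn0 // modnDr.
pose z a := padic_lim p_pr (fP a).
have zP a n : exists y : Zp, z a = (\sum_(i < n | c i == a) p ^ i)%:R + p%:R ^+ n * y.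
  have [|y yE] := @padic_dvdXP n (z a - (\sum_(i < n | c i == a) p ^ i)%:R).
    have zn : (z a) n = ((\sum_(i < n | c i == a) p ^ i)%:R : Zp) n.
      by rewrite residue_nat.
    by rewrite residue_add zn -residue_add subrr residue0.
  by exists y; rewrite -yE subrKC.
pose S n : O := \sum_(i < n) p%:R ^+ i * s (c i).
have tS n : t n = S n + p%:R ^+ n * w n.
  elim: n => [|n IH]; first by rewrite /S big_ord0 add0r mul1r.
  rewrite -(subrK (t n) (t n.+1)) eE IH /S big_ord_recr /= addrCA -addrA.
  by congr (_ + _); rewrite addrC -mulrDr {1}[w n + e n]dvE mulrDr exprSr mulrA.
exists (\sum_a iO (z a) * s a) => n.
rewrite tS opprD addrA; apply: dvdD; last first.
  by apply: dvdN; exists (w n).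
have -> : S n = \sum_a (\sum_(i < n | c i == a) p ^ i)%:R * s a.
  rewrite /S (partition_big (fun i : 'I_n => c i) xpredT) //=.
  apply: eq_bigr => a _; rewrite natr_sum mulr_suml.
  by apply: eq_bigr => i /eqP <-; rewrite natrX.
rewrite -sumrB; elim/big_ind: _ => [||a _]; first by exists 0; rewrite mulr0.
  exact: dvdD.
have [y ->] := zP a n.
rewrite iOD iO_nat iOM -mulrBl addrAC subrr add0r.
have -> : iO (p%:R ^+ n) = p%:R ^+ n by rewrite -natrX iO_nat natrX.
by exists (iO y * s a); rewrite mulrA.
Qed.

Let dvd_expp n x y : dvd n.+1 (x - y) -> dvd n.+2 (x ^+ p - y ^+ p).
Proof.
move=> [u xy]; rewrite subrXX xy.
have [v vE] : exists v, \sum_(i < p) x ^+ (p.-1 - i) * y ^+ i = p%:R * v.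
  apply/unram.2; rewrite rmorph_sum /=.
  have rxy : red x = red y.
    by apply/eqP; rewrite -subr_eq0 -rmorphB xy !rmorphM rmorphXn red_p exprS !mul0r.
  under eq_bigr => i _.
    rewrite rmorphM !rmorphXn rxy -exprD subnK; last first.
      by rewrite -ltnS prednK ?prime_gt0.
    over.
  by rewrite sumr_const card_ord -mulr_natr -(rmorph_nat red) red_p mulr0.
by exists (u * v); rewrite vE mulrACA -exprSr.
Qed.

Let dvd_expX n k x y : dvd n.+1 (x - y) -> dvd n.+1 (x ^+ k - y ^+ k).
Proof. by move=> xy; rewrite subrXX mulrC; apply: dvdMl. Qed.

Hypothesis cardF : exists r, #|F| = (p ^ r)%N.

Let q_expand : exists q', #|F| = (p * q')%N.
Proof.
have [r rE] := cardF; case: r rE => [F1|r ->]; last by exists (p ^ r)%N; rewrite expnS.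
by have := finRing_gt1 F; rewrite F1.
Qed.

Lemma teichmullerP c : c != 0 -> is_teichmuller c (teichmuller c).
Proof.
move=> c0; apply: xgetPex; have [q' qE] := q_expand.
have [y yc] := unram.1 c.
pose t n := y ^+ (#|F| ^ n).
have tS n : t n.+1 = t n ^+ #|F| by rewrite /t expnSr exprM.
have tt n : dvd n.+1 (t n.+1 - t n).
  elim: n => [|n IH].
    have /unram.2[z zE] : red (t 1%N - t 0%N) = 0.
      by rewrite rmorphB !rmorphXn yc expn1 expr1 expf_card subrr.
    by exists z; rewrite expr1.
  rewrite [t n.+2]tS [X in _ - X]tS qE !exprM; apply: dvd_expX.
  exact: dvd_expp.
have [u uP] := complete (fun n => dvdW (leqnSn n) (tt n)).
have uu : u ^+ #|F| = u.
  apply/eqP; rewrite -subr_eq0; apply/eqP/separated => n; apply: (dvdW (leqnSn n)).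
  apply: dvd_trans (dvd_sym (uP n.+1)).
  apply: dvd_trans (dvdW (leqnSn _) (tt n.+1)).
  by rewrite [t n.+2]tS; apply: dvd_expX.
have uc : red u = c.
  have [z /eqP] := uP 1%N; rewrite subr_eq => /eqP ->.
  by rewrite rmorphD rmorphM red_p mul0r add0r rmorphXn yc expn1 expf_card.
exists u; split=> //.
have : u * (u ^+ #|F|.-1 - 1) = 0.
  by rewrite mulrBr -exprS prednK ?uu ?mulr1 ?subrr // (cardD1 0) inE.
case/mulO_eq0 => [u0|/eqP]; last by rewrite subr_eq0 => /eqP.
by move: c0; rewrite -uc u0 rmorph0 eqxx.
Qed.

Lemma teichmuller_unique c t t' :
  is_teichmuller c t -> is_teichmuller c t' -> t = t'.
Proof.
move=> [tq tc] [t'q t'c]; have q_gt1 := finNzRing_gt1 F.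
have q1_gt0 : (0 < #|F|.-1)%N by rewrite -subn1 subn_gt0.
have : (t - t') * (\sum_(i < #|F|.-1) t ^+ (#|F|.-1.-1 - i) * t' ^+ i) = 0.
  by rewrite -subrXX tq t'q subrr.
case/mulO_eq0 => [/eqP|]; first by rewrite subr_eq0 => /eqP.
have cq : c ^+ #|F|.-1 = 1 by rewrite -tc -rmorphXn tq rmorph1.
move=> /(congr1 red); rewrite rmorph0 rmorph_sum /=.
under eq_bigr => i _.
  rewrite rmorphM !rmorphXn /= tc t'c -exprD subnK; last first.
    by rewrite -ltnS prednK.
  over.
rewrite sumr_const card_ord => /eqP; rewrite -mulr_natr mulf_eq0 => /orP[].
  rewrite expf_eq0 => /andP[_ /eqP c0]; move: cq.
  by rewrite c0 expr0n gtn_eqF // => /eqP; rewrite eq_sym oner_eq0.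
have [q' qE] := q_expand; have q0 : #|F|%:R = 0 :> F.
  by rewrite qE natrM -(rmorph_nat red) red_p mul0r.
move: q0; rewrite -{1}(prednK (ltnW q_gt1)) -natr1 => q0 /eqP e.
by move: q0; rewrite e add0r => /eqP; rewrite oner_eq0.
Qed.

End Teichmuller.

(* a lies in Q \cap Z_p, as a subset of Q_p *)
Definition rat_in_padicint (p : nat) (p_pr : prime p) (a : rat) :=
  exists z : padicint p_pr, FracField.tofrac z = ratr a.

(* on Q \cap Z_p, the map ratr : rat -> Z_p is the inclusion *)
Lemma ratr_padicint (p : nat) (p_pr : prime p) (a : rat) :
  rat_in_padicint p_pr a ->
  FracField.tofrac (ratr a : padicint p_pr) = ratr a.
Proof.
move=> [z zE]; set d := `|denq a|%N.
have d_gt0 : (0 < d)%N by rewrite /d absz_gt0 denq_neq0.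
have dE : denq a = d%:Z by rewrite /d absz_denq.
have d0 : (d%:R : padicint p_pr) != 0.
  apply/eqP => /padicintP/(_ d) /eqP; rewrite residue_nat residue0.
  by rewrite modn_small ?eqn0Ngt ?d_gt0 // ltn_expl ?prime_gt1.
have dz : d%:R * z = (numq a)%:~R.
  apply/eqP; rewrite -tofrac_eq tofracM zE /ratr dE rmorph_int rmorph_nat.
  by rewrite mulrCA divff ?mulr1 // -(rmorph_nat (@FracField.tofrac (padicint p_pr))) tofrac_eq0.
have d_unit : (d%:R : padicint p_pr) \is a GRing.unit.
  change (is_true ((d%:R : padicint p_pr) 1%N != 0%N)).
  rewrite residue_nat expn1; apply/negP => /eqP dp.
  have pd : (p %| d)%N by apply/eqP.
  have pn : (p %| `|numq a|)%N.
    have : (`|numq a|%N%:R : padicint p_pr) 1%N = 0%N.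
      have -> : (`|numq a|%N%:R : padicint p_pr) =
          d%:R * (z * (-1) ^+ (numq a < 0)%R).
        rewrite mulrA dz -[LHS]/(`|numq a|%N%:Z%:~R) abszEsign rmorphM mulrC.
        by rewrite rmorphXn rmorphN1.
      by rewrite residue_mul residue_nat expn1 dp mul0n mod0n.
    by rewrite residue_nat expn1 => /eqP.
  have /eqP g1 := coprime_num_den a.
  have : (p %| 1)%N by rewrite -g1 dvdn_gcd pn pd.
  by rewrite dvdn1 => /eqP p1; have := prime_gt1 p_pr; rewrite p1.
by rewrite /ratr dE rmorph_div // rmorph_int rmorph_nat.
Qed.

Definition frac_part (x : rat) : rat := x - (Num.floor x)%:~R.

(* McCarthy's mGm over F_q, q = p ^ r = #|F|, with values in the field L of   *)
(* fractions of Z_q. The order of the parameters is irrelevant, so they are   *)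
(* indexed by an arbitrary finite type I, with m = #|I|.                      *)
Definition padic_hypG (p : nat) (p_pr : prime p) (r : nat)
    (L : fieldExtType {fraction padicint p_pr}) (F : finFieldType)
    (red : {rmorphism ring_of_integers L -> F})
    (I : finType) (a b : I -> rat) (lambda : F) : L :=
  let q := (p ^ r)%N in
  let Gamma (x : rat) : L := padic_in L (morita_gamma (ratr x : padicint p_pr)) in
  let pw (k : nat) : rat := (p ^ k)%N%:R in
  - 1 / (q.-1)%:R *
  \sum_(j < q.-1) (
    let t : rat := j%:R / (q.-1)%:R in
    (- 1) ^+ (j * #|I|) * teichmuller_inv_exp red j lambda *
    \prod_(i : I) \prod_(k < r)
      (Gamma (frac_part ((a i - t) * pw k)) / Gamma (frac_part (a i * pw k)) *
       (Gamma (frac_part ((- b i + t) * pw k)) / Gamma (frac_part (- b i * pw k))) *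
       (- p%:R) ^ (- Num.floor (frac_part (a i * pw k) - t * pw k)
                   - Num.floor (frac_part (- b i * pw k) + t * pw k)))).

(* Main.v *)
(* Put d = (q - 1)/n. Shifting j to j + d replaces a_i - j/(q-1) by           *)
(* a_i - j/(q-1) - 1/n and thus permutes the parameters a_i + l/n cyclically  *)
(* modulo 1, and likewise for the b_i + l/n. The Gamma factors only depend on *)
(* the parameters modulo 1, and the powers of -p lost for the a_i, namely p^k *)
(* at each k, are gained for the b_i. Hence the j-th term of the sum gets     *)
(* multiplied by the n-th root of unity omega(lambda)^-d, which is not 1      *)
(* because lambda is not an n-th power, and the sum vanishes.                 *)
Require Import Defs.
From mathcomp Require Import all_boot all_order all_algebra all_field.
From mathcomp Require Import cyclic ring.

Import Order.TTheory GRing.Theory Num.Theory.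
Local Open Scope ring_scope.

(** In the shift of [j] by [d = (q-1)/n], [prod_hyp_factor_shift] makes the gamma product invariant
    and the sign survives because [d * n = q - 1] is even. Only the character contributes, by a
    factor whose nontriviality comes from [teichmuller_exp_eq1] and [finField_exp_eq1];
    [sum_quasi_periodic] then gives zero. *)

(** The unit group is cyclic: writing [x = z ^+ i] for a generator [z], [x ^+ d = 1] forces [d * n]
    to divide [i * d], so [n] divides [i]. *)
Lemma finField_exp_eq1 (F : finFieldType) (d n : nat) (x : F) :
    (0 < d)%N -> #|F|.-1 = (d * n)%N -> x != 0 -> x ^+ d = 1 ->
  exists y : F, y ^+ n = x.
Proof.
move=> d_gt0 Fdn x0 xd; have q_gt1 := finNzRing_gt1 F.
have q1_gt0 : (0 < #|F|.-1)%N by rewrite -subn1 subn_gt0.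
have unit1 (y : F) : y != 0 -> y ^+ #|F|.-1 = 1.
  move=> y0; apply: (mulfI y0).
  by rewrite mulr1 -exprS prednK ?expf_card // ltnW.
have /hasP[z _ z_prim] :
    has #|F|.-1.-primitive_root [seq y <- enum F | y != 0].
  apply: has_prim_root => //.
  - apply/allP => y; rewrite mem_filter => /andP[y0 _].
    exact/unity_rootP/unit1.
  - by rewrite filter_uniq ?enum_uniq.
  rewrite -(leq_add2l 1) add1n prednK ?(ltnW q_gt1) // cardE.
  rewrite -(count_predC (pred1 (0 : F)) (enum F)) size_filter leq_add2r.
  by rewrite count_uniq_mem ?enum_uniq // leq_b1.
have [[i _] /= xE] := prim_rootP z_prim (unit1 x x0).
move: xd; rewrite xE -exprM => /eqP.
rewrite -(prim_order_dvd z_prim) Fdn mulnC dvdn_pmul2r // => /dvdnP[k kE].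
by exists (z ^+ k); rewrite -exprM kE.
Qed.

(** Successive blocks of length [d] form a geometric progression of ratio [c], and its [n] terms
    cancel. *)
Lemma sum_quasi_periodic (K : idomainType) (d n : nat) (c : K) (f : nat -> K) :
    c ^+ n = 1 -> c != 1 -> (forall j, f (d + j)%N = c * f j) ->
  \sum_(j < d * n) f j = 0.
Proof.
move=> cn c1 fd.
have geomE k : (c - 1) * \sum_(j < d * k) f j = (c ^+ k - 1) * \sum_(j < d) f j.
  elim: k => [|k IH]; first by rewrite muln0 big_ord0 subrr mulr0 mul0r.
  rewrite mulnS big_split_ord /=; under [X in _ * (_ + X)]eq_bigr do rewrite fd.
  by rewrite -mulr_sumr mulrDr mulrCA IH exprS; ring.
have /eqP := geomE n; rewrite cn subrr mul0r mulf_eq0 subr_eq0 (negPf c1).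
by move/eqP.
Qed.

(** The shift sends each factor to the next one; only the last wraps around, to [x + 1], at the cost
    of one [c]. *)
Lemma prod_quasi_periodic_shift (K : comPzRingType) (n : nat) (c : K)
    (f : rat -> K) (x : rat) :
    (0 < n)%N -> (forall y, f (y + 1) = c * f y) ->
  \prod_(l < n) f (x + n%:R^-1 + l%:R / n%:R) =
  c * \prod_(l < n) f (x + l%:R / n%:R).
Proof.
case: n => // n _ f1; rewrite big_ord_recr big_ord_recl /= mul0r addr0.
have n0 : (n.+1%:R : rat) != 0 by rewrite pnatr_eq0.
have -> : x + n.+1%:R^-1 + n%:R / n.+1%:R = x + 1.
  by rewrite -addrA -{1}[_^-1]mul1r -mulrDl nat1r divff.
rewrite f1 mulrC -mulrA; congr (_ * (_ * _)); apply: eq_bigr => l _.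
by rewrite /bump leq0n add1n -[l.+1%:R]nat1r mulrDl mul1r addrA.
Qed.

Lemma floorDnat (x : rat) (m : nat) :
  Num.floor (x + m%:R) = Num.floor x + m%:Z.
Proof. by rewrite floorDrz ?natr_int // (intrKfloor m%:Z). Qed.

Lemma frac_partDnat (x : rat) (m : nat) : frac_part (x + m%:R) = frac_part x.
Proof. by rewrite /frac_part floorDnat rmorphD /=; ring. Qed.

Lemma floor_frac_partD (x y : rat) :
  Num.floor (frac_part x + y) = Num.floor (x + y) - Num.floor x.
Proof.
rewrite /frac_part addrAC -rmorphN /= floorDrz ?intr_int //.
by rewrite intrKfloor.
Qed.

Lemma padic_in_p_neq0 (p : nat) (p_pr : prime p)
    (L : fieldExtType {fraction padicint p_pr}) : (p%:R : L) != 0.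
Proof.
rewrite -(rmorph_nat (padic_in L)) fmorph_eq0 tofrac_eq0.
(* The residue is taken modulo [p ^ 2], since [p] already vanishes modulo [p]. *)
apply/eqP => /padicintP/(_ 2) /eqP.
rewrite residue0 residue_nat modn_small ?eqn0Ngt ?prime_gt0 //.
by rewrite -{1}(expn1 p) ltn_exp2l ?prime_gt1.
Qed.

(** If [c ^+ k = 1], the [k]-th power of the lift of [c] and [1] are both Teichmuller lifts of [1],
    hence equal. *)
Lemma teichmuller_exp_eq1 (p : nat) (p_pr : prime p)
    (L : fieldExtType {fraction padicint p_pr}) (F : finFieldType)
    (red : {rmorphism ring_of_integers L -> F}) (c : F) (k : nat) :
    unramified_with_residue_field red -> (exists r, #|F| = (p ^ r)%N) ->
    c != 0 ->
  (int_val (teichmuller red c) ^+ k == 1) = (c ^+ k == 1).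
Proof.
move=> unram cardF c0.
have [tq tc] := teichmullerP unram cardF c0.
have -> : (int_val (teichmuller red c) ^+ k == 1) =
    (teichmuller red c ^+ k == 1).
  by rewrite -(inj_eq val_inj) rmorphXn rmorph1.
apply/eqP/eqP => [tk|ck]; first by rewrite -tc -rmorphXn tk rmorph1.
apply: (teichmuller_unique unram cardF (c := 1)).
  by split; rewrite ?rmorphXn ?tc // exprAC tq expr1n.
by split; rewrite ?expr1n ?rmorph1.
Qed.

Section HypergeometricTerm.
Variables (L : fieldType) (pi : L) (Gamma : rat -> L).
Hypothesis pi_neq0 : pi != 0.

(* The part of the (i, k) factor of the hypergeometric sum that depends on    *)
(* x = a_i - j/(q-1), resp. x = - b_i + j/(q-1); w stands for p ^ k.          *)
Definition hyp_factor (w : nat) (x : rat) : L :=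
  Gamma (frac_part (x * w%:R)) * pi ^ (- Num.floor (x * w%:R)).

Lemma hyp_factorD1 w x :
  hyp_factor w (x + 1) = pi ^ (- w%:Z) * hyp_factor w x.
Proof.
rewrite /hyp_factor mulrDl mul1r frac_partDnat floorDnat opprD expfzDr //.
by rewrite mulrA mulrC.
Qed.

(** Each product wraps around once; the resulting [pi ^ (- w)] from [a] and [pi ^ w] from [b]
    cancel. *)
Lemma prod_hyp_factor_shift n w (a b t : rat) : (0 < n)%N ->
  \prod_(l < n) (hyp_factor w (a + l%:R / n%:R - (t + n%:R^-1)) *
                 hyp_factor w (- (b + l%:R / n%:R) + (t + n%:R^-1))) =
  \prod_(l < n) (hyp_factor w (a + l%:R / n%:R - t) *
                 hyp_factor w (- (b + l%:R / n%:R) + t)).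
Proof.
(* Reflecting the argument lets the [b] product go through the same shift lemma, with the inverse
   constant. *)
move=> n_gt0; pose g y := hyp_factor w (- y).
have g1 y : g (y + 1) = pi ^ w%:Z * g y.
  have -> : g y = pi ^ (- w%:Z) * g (y + 1).
    by rewrite /g -hyp_factorD1 opprD subrK.
  by rewrite mulrA -expfzDr // subrr expr0z mul1r.
rewrite [LHS]big_split [RHS]big_split /=.
have shiftE (x s : rat) (l : 'I_n) :
    x + l%:R / n%:R - s = (x - s) + l%:R / n%:R.
  by rewrite addrAC.
have gE (s : rat) : \prod_(l < n) hyp_factor w (- (b + l%:R / n%:R) + s) =
    \prod_(l < n) g (b - s + l%:R / n%:R).
  by apply: eq_bigr => l _; rewrite -shiftE /g opprB addrC.
rewrite !gE; under eq_bigr do rewrite shiftE.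
have nV (x : rat) : x - t = x - (t + n%:R^-1) + n%:R^-1 by ring.
under [in RHS]eq_bigr do rewrite shiftE.
rewrite (nV a) (nV b).
have /(_ (a - (t + n%:R^-1))) -> := fun x =>
  prod_quasi_periodic_shift L n _ _ x n_gt0 (hyp_factorD1 w).
have /(_ (b - (t + n%:R^-1))) -> := fun x =>
  prod_quasi_periodic_shift L n _ _ x n_gt0 g1.
by rewrite mulrACA -expfzDr // addNr expr0z mul1r.
Qed.

(** Isolates the dependence on [t]: the last factor is the same for all [j] and leaves the sum. *)
Lemma hyp_term_split w (x y t : rat) :
  Gamma (frac_part ((x - t) * w%:R)) / Gamma (frac_part (x * w%:R)) *
  (Gamma (frac_part ((y + t) * w%:R)) / Gamma (frac_part (y * w%:R))) *
  pi ^ (- Num.floor (frac_part (x * w%:R) - t * w%:R)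
        - Num.floor (frac_part (y * w%:R) + t * w%:R)) =
  (hyp_factor w (x - t) * hyp_factor w (y + t)) *
  (pi ^ (Num.floor (x * w%:R) + Num.floor (y * w%:R)) /
   (Gamma (frac_part (x * w%:R)) * Gamma (frac_part (y * w%:R)))).
Proof.
have regroup (A A' B B' U V W : L) :
    A / A' * (B / B') * (U * V * W) = A * U * (B * V) * (W / (A' * B')).
  by rewrite invfM; ring.
rewrite !floor_frac_partD -mulrBl -mulrDl /hyp_factor.
set u := Num.floor _; set v := Num.floor _; set f := Num.floor _.
set g := Num.floor _.
have -> : - (u - v) - (f - g) = - u + - f + (v + g) by ring.
rewrite (expfzDr (- u - f) (v + g) pi_neq0) (expfzDr (- u) (- f) pi_neq0).
exact: regroup.
Qed.

End HypergeometricTerm.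

Theorem theorem2p9
  (n : nat) (n_gt0 : (0 < n)%N)
  (p : nat) (p_pr : prime p) (p_odd : odd p) (r : nat)
  (q_mod_n : (p ^ r = 1 %[mod n])%N)
  (F : finFieldType) (cardF : #|F| = (p ^ r)%N)
  (L : fieldExtType {fraction padicint p_pr})
  (red : {rmorphism ring_of_integers L -> F})
  (unram : unramified_with_residue_field red)
  (m : nat) (m_gt0 : (0 < m)%N) (a b : 'I_m -> rat)
  (a_int : forall i, rat_in_padicint p_pr (a i))
  (b_int : forall i, rat_in_padicint p_pr (b i))
  (lambda : F) (lambda_npow : ~ exists x : F, x ^+ n = lambda) :
  padic_hypG r red
    (fun il : 'I_m * 'I_n => a il.1 + il.2%:R / n%:R)
    (fun il : 'I_m * 'I_n => b il.1 + il.2%:R / n%:R)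
    lambda = 0.
Proof.
have lambda0 : lambda != 0.
  by apply/eqP => l0; apply: lambda_npow; exists 0; rewrite l0 expr0n gtn_eqF.
have q_gt1 : (1 < p ^ r)%N by rewrite -cardF finNzRing_gt1.
have [d qd] : exists d, (p ^ r).-1 = (d * n)%N.
  by apply/dvdnP; rewrite -subn1 -eqn_mod_dvd ?(ltnW q_gt1) //; apply/eqP.
have d_gt0 : (0 < d)%N.
  have : (0 < d * n)%N by rewrite -qd -subn1 subn_gt0.
  by rewrite muln_gt0 => /andP[].
have dn_even : ~~ odd (d * n).
  by rewrite -qd -subn1 oddB ?(ltnW q_gt1) // oddX p_odd orbT.
have tP k := teichmuller_exp_eq1 p p_pr L F red lambda k unram
  (ex_intro _ r cardF) lambda0.
have pi0 : (- p%:R : L) != 0 by rewrite oppr_eq0 padic_in_p_neq0.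
pose Gamma (x : rat) : L := padic_in L (morita_gamma (ratr x : padicint p_pr)).
pose hf k := hyp_factor L (- p%:R) Gamma (p ^ k)%N.
pose H (s : rat) := \prod_(il : 'I_m * 'I_n) \prod_(k < r)
  (hf k (a il.1 + il.2%:R / n%:R - s) * hf k (- (b il.1 + il.2%:R / n%:R) + s)).
have HD s : H (s + n%:R^-1) = H s.
  have HE v : H v = \prod_(i < m) \prod_(l < n) \prod_(k < r)
      (hf k (a i + l%:R / n%:R - v) * hf k (- (b i + l%:R / n%:R) + v)).
    by rewrite pair_bigA.
  rewrite !HE.
  (* The product over [l] must be innermost: the cancellation takes place for each [i] and [k]
     separately. *)
  apply: eq_bigr => i _; rewrite exchange_big [RHS]exchange_big.
  by apply: eq_bigr => k _; apply: prod_hyp_factor_shift.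
pose u : L := int_val (teichmuller red lambda).
pose f j := (-1) ^+ (j * (m * n)) * u^-1 ^+ j * H (j%:R / (d * n)%:R).
pose C : L := \prod_(il : 'I_m * 'I_n) \prod_(k < r)
  ((- p%:R) ^ (Num.floor ((a il.1 + il.2%:R / n%:R) * (p ^ k)%N%:R) +
               Num.floor (- (b il.1 + il.2%:R / n%:R) * (p ^ k)%N%:R)) /
   (Gamma (frac_part ((a il.1 + il.2%:R / n%:R) * (p ^ k)%N%:R)) *
    Gamma (frac_part (- (b il.1 + il.2%:R / n%:R) * (p ^ k)%N%:R)))).
have -> : padic_hypG r red
    (fun il : 'I_m * 'I_n => a il.1 + il.2%:R / n%:R)
    (fun il : 'I_m * 'I_n => b il.1 + il.2%:R / n%:R) lambda =
    - 1 / (d * n)%:R * ((\sum_(j < d * n) f j) * C).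
  rewrite /padic_hypG qd; congr (_ * _); rewrite mulr_suml.
  apply: eq_bigr => j _.
  rewrite card_prod !card_ord /teichmuller_inv_exp (negPf lambda0) -[RHS]mulrA.
  congr (_ * _); rewrite /H /C -big_split /=; apply: eq_bigr => il _.
  rewrite -big_split /=; apply: eq_bigr => k _.
  exact: hyp_term_split.
rewrite (sum_quasi_periodic _ _ _ (u^-1 ^+ d)) ?mul0r ?mulr0 //.
- apply/eqP; rewrite -exprM exprVn invr_eq1 tP -qd -cardF.
  apply/eqP/(mulfI lambda0); rewrite mulr1 -exprS prednK ?expf_card //.
  by rewrite cardF (ltnW q_gt1).
(* A trivial ratio would mean [lambda ^+ d = 1], making [lambda] an [n]-th power. *)
- rewrite exprVn invr_eq1 tP; apply/eqP => ld; apply: lambda_npow.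
  by apply: (finField_exp_eq1 _ d) => //; rewrite cardF.
move=> j; rewrite /f natrD mulrDl addrC.
have -> : (d%:R / (d * n)%:R : rat) = n%:R^-1.
  by rewrite natrM invfM mulrA divff ?mul1r // pnatr_eq0 -lt0n.
have -> : (-1) ^+ ((d + j) * (m * n)) = (-1) ^+ (j * (m * n)) :> L.
  rewrite -signr_odd mulnDl oddD [(d * _)%N]mulnCA oddM (negPf dn_even).
  by rewrite andbF addFb signr_odd.
by rewrite HD exprD !mulrA [_ * u^-1 ^+ d]mulrC.
Qed.
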